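(* For every integer $k\geq 1$, let $h(k)$ denote the minimum integer $d$ such that every graph of minimum degree at least $d$ contains $k$ pairwise vertex-disjoint cycles, each of even length, whose lengths are pairwise different. Then (a) $h(k)$ exists, and (b) $h(k)=k^2+3k-1$.
   Context: All graphs are finite and simple. The length of a cycle is its number of vertices. *)

(* Defs.v *)
From mathcomp Require Import all_boot.

Set Implicit Arguments.
Unset Strict Implicit.
Unset Printing Implicit Defensive.

Record sgraph := SGraph {
  vertex :> finType;
  adj : rel vertex;
  adj_sym : symmetric adj;
  adj_irr : irreflexive adj
}.

Definition degree (G : sgraph) (x : G) : nat := #|[set y : G | adj x y]|.

(* The minimum degree of the graph without vertices is undefined, hence the
   first conjunct: the null graph has minimum degree at least [d] for no [d]. *)
Definition min_degree_ge (G : sgraph) (d : nat) : Prop :=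
  0 < #|G| /\ forall x : G, d <= degree x.

(* A cycle is given by its vertices in cyclic order. MathComp's [cycle] accepts
   the empty sequence and, for symmetric relations, [:: x; y], so the lower
   bound on the length is needed. *)
Definition is_cycle (G : sgraph) (c : seq G) : bool :=
  [&& cycle (@adj G) c, uniq c & 3 <= size c].

Definition has_disjoint_even_cycles (k : nat) (G : sgraph) : Prop :=
  exists c : 'I_k -> seq G,
    [/\ forall i, is_cycle (c i),
        forall i, ~~ odd (size (c i)),
        forall i j, i != j -> [disjoint c i & c j]
      & forall i j, i != j -> size (c i) != size (c j)].

Definition forces_disjoint_even_cycles (k d : nat) : Prop :=
  forall G : sgraph, min_degree_ge G d -> has_disjoint_even_cycles k G.

(* "h(k) is defined and equal to d". Restricting to natural numbers loses
   nothing: for k >= 1 no d <= 0 forces a cycle (one-vertex graph). *)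
Definition is_h (k d : nat) : Prop :=
  forces_disjoint_even_cycles k d /\
  forall d' : nat, forces_disjoint_even_cycles k d' -> d <= d'.

(* Main.v *)
(* Induct on k. Deleting one vertex lowers degrees by at most 1, so the remaining
   graph contains k - 1 disjoint even cycles of different lengths, and these do
   not cover the graph. Take such a family of small total length. A vertex
   outside the family with at least 2i + 3 neighbours on the i-th shortest cycle
   C closes up, through C, even cycles of i + 1 lengths at most |C|, so C can be
   replaced by a shorter cycle of a new length. Otherwise every outside vertex has
   at most 4 + 6 + ... + 2k = (k - 1)(k + 2) neighbours on the family, hence at
   least 2k + 1 outside it, and a longest path outside the family yields even
   cycles of k lengths, one of which is new. The bound is attained since k
   different even lengths sum to at least 4 + 6 + ... + 2(k + 1) = k^2 + 3k, more
   than the order of the complete graph on k^2 + 3k - 1 vertices. *)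

Require Import Defs.
From mathcomp Require Import all_boot.
From mathcomp Require Import zify.

Set Implicit Arguments.
Unset Strict Implicit.
Unset Printing Implicit Defensive.

(** * Sums of distinct natural numbers *)

(** Each pair of entries is counted once, at its larger entry, so the sum is [n(n-1)/2] for [n]
    entries. *)
Lemma sum_count_ltn (s : seq nat) : uniq s ->
  (\sum_(x <- s) count (ltn^~ x) s).*2 + size s = size s ^ 2.
Proof.
elim: s => [|a s IHs] /=; first by rewrite big_nil.
move=> /andP[a_s s_uniq]; rewrite big_cons /= ltnn add0n big_split /=.
have -> : \sum_(x <- s) (a < x : nat) = count (fun x => a < x) s.
  by rewrite -sum1_count [RHS]big_mkcond; apply: eq_bigr => x _; case: ltnP.
have count_a : count (ltn^~ a) s + count (fun x => a < x) s = size s.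
  rewrite -(count_predC (ltn^~ a) s); congr (_ + _).
  apply: eq_in_count => x x_s /=; rewrite -leqNgt ltn_neqAle.
  by case: eqVneq => // ax; rewrite ax x_s in a_s.
have := IHs s_uniq; rewrite -[in _.+1 ^ 2]addn1 sqrnD /=.
rewrite addnA count_a; move: (\sum_(x <- s) _) => m; lia.
Qed.

(** At most [x] distinct naturals lie below [x], so each entry bounds its own count. *)
Lemma sum_uniq_ge (s : seq nat) : uniq s -> size s ^ 2 <= (sumn s).*2 + size s.
Proof.
move=> s_uniq; rewrite -(sum_count_ltn s_uniq) leq_add2r leq_double sumnE.
apply: leq_sum => x _; rewrite -size_filter -[leqRHS](size_iota 0).
apply: uniq_leq_size; first exact: filter_uniq.
by move=> y; rewrite mem_filter mem_iota add0n => /andP[].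
Qed.

(** * Even cycles formed by a vertex and a path *)

Section EvenCycles.
Variable G : sgraph.
Implicit Types (v x y : G) (p c : seq G) (cs : seq (seq G)) (S : {set G}).

Local Notation even_cycle c := (is_cycle c && ~~ odd (size c)).

Lemma chord_cycle v p a b : sorted (@adj G) p -> uniq p -> v \notin p ->
    a < b < size p -> adj v (nth v p a) -> adj v (nth v p b) ->
  let c := v :: take (b - a).+1 (drop a p) in
  [/\ is_cycle c, size c = b - a + 2 & {subset c <= v :: p}].
Proof.
move=> p_path p_uniq vp /andP[ab bp] va vb.
set q := take _ _.
have q_p : {subset q <= p} by move=> x /mem_take /mem_drop.
have q_size : size q = (b - a).+1 by rewrite size_takel // size_drop; lia.
have q_last : last v q = nth v p b.
  by rewrite -nth_last q_size nth_take // nth_drop; congr nth; lia.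
have q_path : path (@adj G) v q.
  have : sorted (@adj G) q by apply/take_sorted/drop_sorted.
  have : head v q = nth v p a.
    by rewrite -nth0 nth_take // nth_drop addn0.
  by case: q {q_p q_last} q_size => //= x q _ ->; rewrite va.
split.
- rewrite /is_cycle /= rcons_path q_path q_last adj_sym vb /= q_size.
  rewrite take_uniq ?drop_uniq // andbT; apply/andP; split; last lia.
  by apply: contra vp => /q_p.
- by rewrite /= q_size; lia.
- by move=> x; rewrite !inE => /predU1P[->|/q_p ->]; rewrite ?eqxx ?orbT.
Qed.

(* Among 2t+1 neighbours on the path, t+1 have positions of the same parity;
   closing up at the first of them and at each later one gives t lengths. *)
Lemma even_cycle_avoiding v p t (bad : seq nat) :
    sorted (@adj G) p -> uniq p -> v \notin p ->
    t.*2 < count (@adj G v) p -> size bad < t ->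
  exists c, [/\ even_cycle c, {subset c <= v :: p} & size c \notin bad].
Proof.
move=> p_path p_uniq vp p_count bad_size.
pose nb b i := adj v (nth v p i) && (odd i == b).
have [b nb_count] : exists b, t < count (nb b) (iota 0 (size p)).
  have : count (@adj G v) p =
      count (nb true) (iota 0 (size p)) + count (nb false) (iota 0 (size p)).
    rewrite -{1}(mkseq_nth v p) count_map -count_predUI.
    rewrite [X in _ + X](eq_count (a2 := pred0)) ?count_pred0 ?addn0.
      by apply: eq_count => i; rewrite /= /nb; case: odd; rewrite ?andbT ?andbF ?orbF.
    by move=> i; rewrite /= /nb; case: odd; rewrite ?andbF.
  case: (ltnP t (count (nb true) (iota 0 (size p)))) => ?; first by exists true.
  by exists false; lia.
move: nb_count; rewrite -size_filter.
have : sorted ltn (filter (nb b) (iota 0 (size p))).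
  exact/(sorted_filter ltn_trans)/iota_ltn_sorted.
have : {subset filter (nb b) (iota 0 (size p)) <= [pred i | nb b i && (i < size p)]}.
  by move=> i; rewrite mem_filter mem_iota inE.
have : uniq (filter (nb b) (iota 0 (size p))) by rewrite filter_uniq ?iota_uniq.
case: (filter _ _) => //= a s s_uniq s_nb /(order_path_min ltn_trans) a_s.
rewrite ltnS => s_size.
(* Pigeonhole: the positions in [s] give at least [t] distinct lengths, too many to lie all in
   [bad]. *)
have [j j_s j_bad] : exists2 j, j \in s & j - a + 2 \notin bad.
  apply/hasP; apply: contraTT bad_size; rewrite -all_predC => /allP s_bad.
  rewrite -leqNgt; apply: leq_trans s_size _; rewrite -(size_map (fun j => j - a + 2)).
  apply: uniq_leq_size.
    rewrite map_inj_in_uniq; first by case/andP: s_uniq.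
    by move=> i j /(allP a_s) /= ai /(allP a_s) /= aj; lia.
  by move=> _ /mapP[j /s_bad /negPn ? ->].
have /andP[/andP[va /eqP oa] _] := s_nb a (mem_head _ _).
have /andP[/andP[vj /eqP oj] jp] := s_nb j (mem_behead (s := a :: s) j_s).
have aj : a < j := allP a_s _ j_s.
have ajp : a < j < size p by rewrite aj.
have [c_cyc c_size c_sub] := chord_cycle p_path p_uniq vp ajp va vj.
exists (v :: take (j - a).+1 (drop a p)); rewrite c_cyc c_size; split=> //.
by rewrite oddD oddB ?(ltnW aj) // oj oa addbb.
Qed.

(** The path is extended at its head while a neighbour in [S] is off it; each extension uses up a
    vertex of [S], so this stops. *)
Lemma maximal_path S v : v \in S ->
  exists x p, [/\ path (@adj G) x p, uniq (x :: p), {subset x :: p <= S}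
    & {subset [set y in S | adj x y] <= p}].
Proof.
move=> vS; have : {subset [:: v] <= S} by move=> x; rewrite inE => /eqP->.
have : uniq [:: v] by [].
have : path (@adj G) v [::] by [].
have [n] := ubnP (#|S| - size [:: v]).
move: [::] => p; elim: n v {vS} p => // n IHn v p lt_n vp v_uniq pS.
have [/subsetP vN|/subsetPn[y]] := boolP ([set y in S | adj v y] \subset p).
  by exists v, p.
rewrite inE => /andP[yS vy] yp.
have yvp : y \notin v :: p.
  by rewrite inE negb_or yp andbT; apply: contraTneq vy => ->; rewrite adj_irr.
have ypS : {subset y :: v :: p <= S}.
  by move=> x; rewrite inE => /predU1P[->//|/pS].
have y_uniq : uniq (y :: v :: p) by rewrite cons_uniq yvp.
apply: (IHn y (v :: p)) => //; last by rewrite /= adj_sym vy.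
have : size (y :: v :: p) <= #|S|.
  by rewrite cardE; apply: uniq_leq_size => // x /ypS; rewrite mem_enum.
by move: lt_n => /=; lia.
Qed.

(** * Families of disjoint even cycles of distinct lengths *)

(** A list makes it easy to add and remove cycles; uniqueness of the concatenation expresses
    disjointness. *)
Definition even_family S cs := [/\ {in cs, forall c, even_cycle c},
  uniq (flatten cs), {subset flatten cs <= S} & uniq (map size cs)].

Lemma even_family_perm S cs cs' :
  perm_eq cs cs' -> even_family S cs -> even_family S cs'.
Proof.
move=> eq_cs [cs_cyc cs_uniq cs_S cs_size]; split.
- by move=> c; rewrite -(perm_mem eq_cs) => /cs_cyc.
- by rewrite -(perm_uniq (perm_flatten eq_cs)).
- by move=> x; rewrite -(perm_mem (perm_flatten eq_cs)) => /cs_S.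
- by rewrite -(perm_uniq (perm_map size eq_cs)).
Qed.

Lemma even_family_cons S c cs : even_family S cs -> even_cycle c ->
    {subset c <= S} -> {in c, forall x, x \notin flatten cs} ->
  size c \notin map size cs -> even_family S (c :: cs).
Proof.
move=> [cs_cyc cs_uniq cs_S cs_size] c_cyc cS c_cs c_size; split.
- by move=> d; rewrite inE => /predU1P[->|/cs_cyc].
- rewrite /= cat_uniq cs_uniq andbT; case/andP: c_cyc => /and3P[_ -> _] _ /=.
  by apply/hasPn => x x_cs; apply: contraL x_cs => /c_cs.
- by move=> x; rewrite mem_cat => /orP[/cS|/cs_S].
- by rewrite /= c_size.
Qed.

Lemma even_family_behead S c cs : even_family S (c :: cs) -> even_family S cs.
Proof.
move=> [cs_cyc /=]; rewrite cat_uniq => /and3P[_ _ cs_uniq] cs_S /andP[_ cs_size].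
split=> // [d d_cs|x x_cs]; first by rewrite cs_cyc // inE d_cs orbT.
by rewrite cs_S // mem_cat x_cs orbT.
Qed.

(** As lengths are distinct, this is the position of [c] by length, counted from 0: the i-th
    shortest cycle has rank [i - 1]. *)
Definition rank cs c := count (ltn^~ (size c)) (map size cs).

Lemma even_family_shorten S cs c v : even_family S cs -> c \in cs ->
    v \in S -> v \notin flatten cs ->
    (rank cs c).+2.*2 < count (@adj G v) c ->
  exists cs', [/\ even_family S cs', size cs' = size cs
    & size (flatten cs') < size (flatten cs)].
Proof.
move=> cs_fam c_cs vS v_cs vc.
have eq_cs := perm_to_rem c_cs; set ds := rem c cs in eq_cs.
have [cds_cyc cds_uniq cds_S cds_size] := even_family_perm eq_cs cs_fam.
have ds_fam := even_family_behead (even_family_perm eq_cs cs_fam).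
have /andP[/and3P[c_cyc c_uniq c_ge3] c_even] := cds_cyc c (mem_head _ _).
have v_cds : v \notin c ++ flatten ds by rewrite (perm_mem (perm_flatten eq_cs)) in v_cs.
have v_c : v \notin c by apply: contra v_cds; rewrite mem_cat => ->.
have c_path : sorted (@adj G) c.
  by case: (c) c_cyc => //= x p; rewrite rcons_path => /andP[].
(* These are [rank cs c + 1] forbidden lengths, one fewer than the lengths that [v] provides. Longer
   lengths need no ban, since the new cycle is shorter than [c]. *)
pose bad := size c :: filter (ltn^~ (size c)) (map size cs).
have [|c' [c'_cyc c'_sub]] := even_cycle_avoiding
  c_path c_uniq v_c vc (bad := bad).
  by rewrite /= size_filter.
rewrite inE mem_filter !negb_or => /andP[c'_ne c'_bad].
(* Lying in [v :: c], the cycle [c'] has at most [size c + 1] vertices; parity excludes equality,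
   and [bad] excludes [size c]. *)
have c'_lt : size c' < size c.
  have := uniq_leq_size _ c'_sub; case/andP: c'_cyc => /and3P[_ -> _] odd_c'.
  move=> /(_ isT); rewrite leq_eqVlt => /predU1P[eq_c'|].
    by rewrite eq_c' /= c_even in odd_c'.
  by rewrite ltnS leq_eqVlt (negPf c'_ne).
exists (c' :: ds); split.
- apply: even_family_cons => //.
  + by move=> x /c'_sub; rewrite inE => /predU1P[->//|xc]; rewrite cds_S //= mem_cat xc.
  + move=> x /c'_sub; rewrite inE => /predU1P[->|xc].
      by apply: contra v_cds; rewrite mem_cat orbC => ->.
    move: cds_uniq; rewrite /= cat_uniq => /and3P[_ /hasPn c_ds _].
    by apply: contraL xc => /c_ds.
  + move: c'_bad; rewrite /= c'_lt; apply: contra => /mapP[d d_ds ->].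
    by rewrite map_f // (mem_rem d_ds).
- by rewrite (perm_size eq_cs).
- by rewrite (perm_size (perm_flatten eq_cs)) /= !size_cat ltn_add2r.
Qed.

Lemma card_nbrs_split S cs v : #|[set y in S | adj v y]| <=
  #|[set y in S :\: [set x in flatten cs] | adj v y]|
    + count (@adj G v) (flatten cs).
Proof.
rewrite -(cardsID [set x in flatten cs]) addnC leq_add //.
  by apply/subset_leq_card/subsetP => y; rewrite !inE => /and3P[-> -> ->].
rewrite -size_filter; apply: leq_trans (card_size _).
by apply/subset_leq_card/subsetP => y; rewrite !inE mem_filter => /andP[/andP[_ ->]].
Qed.

(** The ranks of [m] cycles are 0, ..., [m - 1], so this is 4 + 6 + ... + (2m + 2). *)
Lemma sum_rank S cs : even_family S cs ->
  \sum_(c <- cs) (rank cs c).+2.*2 = size cs ^ 2 + 3 * size cs.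
Proof.
move=> [_ _ _ /sum_count_ltn]; rewrite big_map size_map => <-.
rewrite (eq_bigr (fun c => 2 * rank cs c + 4)); last by move=> c _; lia.
rewrite big_split /= -big_distrr /= big_const_seq count_predT iter_addn_0.
move: (\sum_(c <- cs) _). lia.
Qed.

Lemma even_family_succ S cs : even_family S cs -> size (flatten cs) < #|S| ->
    {in S, forall v, (size cs).+1 ^ 2 + 3 * (size cs).+1 - 1 <=
      #|[set y in S | adj v y]|} ->
  exists cs', even_family S cs' /\ size cs' = (size cs).+1.
Proof.
(* Induction on the total length replaces the choice of a shortest family. *)
have [n] := ubnP (size (flatten cs)); elim: n cs => // n IHn cs lt_n cs_fam cs_lt S_deg.
pose S' := S :\: [set x in flatten cs].
have [/exists_inP[v]|/exists_inPn few] := boolP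
    [exists v in S', has (fun c => (rank cs c).+2.*2 < count (@adj G v) c) cs].
  rewrite !inE => /andP[v_cs vS] /hasP[c c_cs vc].
  have [cs' [cs'_fam cs'_size cs'_lt]] := even_family_shorten cs_fam c_cs vS v_cs vc.
  rewrite -cs'_size in S_deg *; apply: IHn => //; last exact: ltn_trans cs_lt.
  exact: leq_trans cs'_lt lt_n.
(* With [m = size cs], the degree bound exceeds [m^2 + 3m] by exactly [2m + 3]. *)
have S'_deg v : v \in S' -> (size cs).+1.*2 < #|[set y in S' | adj v y]|.
  move=> vS'; have vS : v \in S by move: vS'; rewrite inE => /andP[].
  have count_le : count (@adj G v) (flatten cs) <= size cs ^ 2 + 3 * size cs.
    rewrite -(sum_rank cs_fam) count_flatten sumnE big_map.
    rewrite big_seq [leqRHS]big_seq; apply: leq_sum => c c_cs.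
    by rewrite leqNgt; have /hasPn -> := few v vS'.
  have := S_deg v vS; have := card_nbrs_split S cs v; rewrite -/S' -[in _.+1 ^ 2]addn1 sqrnD.
  by lia.
have [v vS'] : exists v, v \in S'.
  apply/set0Pn; rewrite -card_gt0 cardsD subn_gt0.
  apply: leq_ltn_trans cs_lt; apply: leq_trans (card_size _).
  by apply/subset_leq_card/subsetP => x; rewrite !inE => /andP[].
have [x [p [xp_path xp_uniq xp_S' x_max]]] := maximal_path vS'.
have /andP[x_p p_uniq] := xp_uniq.
have xp_count : (size cs).+1.*2 < count (@adj G x) p.
  apply: leq_trans (S'_deg x (xp_S' x (mem_head _ _))) _.
  rewrite -size_filter; apply: leq_trans (card_size _).
  apply/subset_leq_card/subsetP => y y_nb; rewrite mem_filter x_max // andbT.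
  by move: y_nb; rewrite inE => /andP[].
(* The [m] lengths already present are forbidden, against [m + 1] available ones. *)
have [|c [c_cyc c_sub c_size]] := even_cycle_avoiding
  (path_sorted xp_path) p_uniq x_p xp_count (bad := map size cs).
  by rewrite size_map.
have cS' : {subset c <= S'} by move=> y /c_sub /xp_S'.
exists (c :: cs); split=> //; apply: even_family_cons => // y /cS'; rewrite !inE.
  by case/andP.
by case/andP.
Qed.

(** Counting neighbours inside [S] stands for degrees in the induced subgraph, so deleting a vertex
    only shrinks [S]. *)
Lemma even_family_exists k S : 0 < #|S| ->
    {in S, forall v, k ^ 2 + 3 * k - 1 <= #|[set y in S | adj v y]|} ->
  exists cs, even_family S cs /\ size cs = k.
Proof.
elim: k S => [|k IHk] S S_gt0 S_deg; first by exists [::].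
have /set0Pn[u uS] : S != set0 by rewrite -card_gt0.
have nbr_u v : #|[set y in S | adj v y]| <= #|[set y in S :\ u | adj v y]|.+1.
  rewrite -add1n -(cards1 u); apply: leq_trans (leq_card_setU _ _).
  apply/subset_leq_card/subsetP => y; rewrite !inE => /andP[-> ->].
  by case: eqVneq.
have [||cs [cs_fam cs_k]] := IHk (S :\ u).
(* A neighbour of [u] survives the deletion, so [S :\ u] is nonempty. *)
- have := S_deg u uS; have := nbr_u u.
  have : #|[set y in S :\ u | adj u y]| <= #|S :\ u|.
    by apply/subset_leq_card/subsetP => y; rewrite inE => /andP[].
  by rewrite -[in _.+1 ^ 2]addn1 sqrnD; lia.
- move=> v; rewrite inE => /andP[_ vS]; have := S_deg v vS; have := nbr_u v.
  by rewrite -[in _.+1 ^ 2]addn1 sqrnD; lia.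
- have [cs_cyc cs_uniq cs_S cs_size] := cs_fam; rewrite -cs_k in S_deg *.
  apply: even_family_succ => //.
    by split=> // x /cs_S; rewrite inE => /andP[].
  (* The family misses [u], hence does not cover [S]. *)
  rewrite (cardsD1 u S) uS add1n ltnS cardE.
  by apply: uniq_leq_size => // x /cs_S; rewrite mem_enum.
Qed.

End EvenCycles.

(** * The upper bound, by passing from lists to indexed families *)

Lemma even_family_disjoint (G : sgraph) (S : {set G}) (cs : seq (seq G)) :
  even_family S cs -> has_disjoint_even_cycles (size cs) G.
Proof.
move=> [cs_cyc cs_uniq _ cs_size].
have cs_nth (i : 'I_(size cs)) : nth [::] cs i \in cs by rewrite mem_nth.
exists (fun i => nth [::] cs i); split=> [i|i|i j ij|i j].
- by have /andP[] := cs_cyc _ (cs_nth i).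
- by have /andP[] := cs_cyc _ (cs_nth i).
- have : pairwise (fun c d => [disjoint c & d]) cs.
    elim: cs cs_uniq {cs_cyc cs_size i j ij cs_nth} => //= c cs IHcs.
    rewrite cat_uniq => /and3P[_ c_cs /IHcs ->]; rewrite andbT.
    apply/allP => d d_cs; rewrite disjoint_sym disjoint_has.
    apply: contra c_cs => /hasP[x x_d x_c]; apply/hasP; exists x => //.
    by apply/flattenP; exists d.
  move/(pairwiseP [::]) => cs_disj.
  case: (ltngtP i j) => [lt_ij|lt_ji|/val_inj eq_ij].
  + by apply: cs_disj; rewrite ?inE.
  + by rewrite disjoint_sym; apply: cs_disj; rewrite ?inE.
  + by rewrite eq_ij eqxx in ij.
- by apply: contraNneq => eq_ij; rewrite -val_eqE /=
    -(nth_uniq 0 _ _ cs_size) ?size_map // !(nth_map [::]) // eq_ij.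
Qed.

Lemma forces_upper k : forces_disjoint_even_cycles k (k ^ 2 + 3 * k - 1).
Proof.
move=> G [G_gt0 G_deg].
have [||cs [cs_fam <-]] := @even_family_exists G k [set: G].
- by rewrite cardsT.
- move=> v _; apply: leq_trans (G_deg v) _.
  by apply/subset_leq_card/subsetP => y; rewrite !inE.
- exact: even_family_disjoint cs_fam.
Qed.

(** * The lower bound, by counting vertices of complete graphs *)

Lemma disjoint_even_cycles_card k (G : sgraph) :
  has_disjoint_even_cycles k G -> k ^ 2 + 3 * k <= #|G|.
Proof.
move=> [c [c_cyc c_even c_disj c_size]].
have sum_le : \sum_i size (c i) <= #|G|.
  rewrite -cardsT; apply: leq_trans (subset_leq_card (subsetT (\bigcup_i [set x in c i]))).
  rewrite -sum1_card partition_disjoint_bigcup /=.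
    apply: leq_sum => i _; rewrite sum1_card cardsE.
    by have /and3P[_ /card_uniqP -> _] := c_cyc i.
  move=> i j /c_disj; rewrite (eq_disjoint (in_set _)); apply: etrans.
  by apply: eq_disjoint_r => x; rewrite inE.
apply: leq_trans sum_le.
(* An even cycle has at least 4 vertices, so nothing is truncated. The [m i] are distinct naturals
   with sum at least [k(k-1)/2]; doubling and adding [4k] gives [k^2 + 3k]. *)
pose m i := (size (c i) - 4)./2.
have size_c i : size (c i) = (m i).*2 + 4.
  by have /and3P[_ _] := c_cyc i; move: (c_even i); rewrite /m; lia.
have : uniq (map m (enum 'I_k)).
  rewrite map_inj_uniq ?enum_uniq // => i j eq_m.
  by apply/eqP; apply: contraT => /c_size; rewrite !size_c eq_m eqxx.
move=> /sum_uniq_ge; rewrite size_map size_enum_ord sumnE big_map big_enum (eq_bigl predT) //.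
rewrite (eq_bigr _ (fun i _ => size_c i)) big_split /= sum_nat_const card_ord.
have -> : \sum_i (m i).*2 = (\sum_i m i).*2.
  by rewrite -muln2 big_distrl /=; apply: eq_bigr => i _; rewrite -muln2.
by move: (\sum_i m i) => s; lia.
Qed.

Lemma neq_sym (T : eqType) : symmetric (fun x y : T => x != y).
Proof. by move=> x y; rewrite eq_sym. Qed.

Lemma neq_irr (T : eqType) : irreflexive (fun x y : T => x != y).
Proof. by move=> x; rewrite eqxx. Qed.

Definition complete_graph n := SGraph (@neq_sym 'I_n) (@neq_irr 'I_n).

(** The complete graph on [d + 1] vertices has minimum degree [d], so the forced cycles must fit
    into [d + 1] vertices. *)
Lemma forces_lower k d :
  forces_disjoint_even_cycles k d -> k ^ 2 + 3 * k - 1 <= d.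
Proof.
move=> d_forces.
have K_deg : min_degree_ge (complete_graph d.+1) d.
  split=> [|x]; first by rewrite card_ord.
  have -> : degree x = #|[set~ x]|.
    by apply: eq_card => y; rewrite !inE /= eq_sym.
  by rewrite cardsC1 card_ord.
by have := disjoint_even_cycles_card (d_forces _ K_deg); rewrite card_ord; lia.
Qed.

Theorem theorem2p14 (k : nat) (hk : 1 <= k) :
  (exists d : nat, is_h k d) /\
  (forall d : nat, is_h k d -> d = k ^ 2 + 3 * k - 1).
Proof.
split=> [|d [d_forces d_min]].
  by exists (k ^ 2 + 3 * k - 1); split; [apply: forces_upper | move=> d; apply: forces_lower].
by apply/eqP; rewrite eqn_leq d_min ?forces_lower //; apply: forces_upper.
Qed.
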